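(* Let $\theta^1,\theta^2,\theta^3$ be real numbers such that $1,\theta^1,\theta^2,\theta^3$ are linearly independent over $\mathbb{Z}$, and let $\Theta=(\theta^1,\theta^2,\theta^3)$ (the case $m=3$, $n=1$). Then $$\beta(\Theta)\geqslant \alpha(\Theta)\, g_2(\alpha(\Theta)),$$ where for $\alpha\geqslant 3$ $$g_2(\alpha)=\sqrt{\alpha+\frac{1}{\alpha^2}-\frac74}+\frac1\alpha-\frac12 .$$
   Context: For real $t$, $\|t\|$ denotes the distance from $t$ to the nearest integer. For a real $n\times m$ matrix $\Theta=(\theta_j^i)$ consider the linear forms $L_j(\mathbf{x})=\sum_{i=1}^m\theta_j^i x_i$, $1\le j\le n$, $\mathbf{x}=(x_1,\dots,x_m)$, and $M(\mathbf{x})=\max_{1\le i\le m}|x_i|$. Define $$\psi_\Theta(t)=\min_{\mathbf{x}\in\mathbb{Z}^m:\,0<M(\mathbf{x})\le t}\ \max_{1\le j\le n}\|L_j(\mathbf{x})\|.$$ Assuming $\psi_\Theta(t)>0$ for all $t>0$, the uniform exponent $\alpha(\Theta)$ is the supremum of the set of $\gamma>0$ with $\limsup_{t\to+\infty}t^\gamma\psi_\Theta(t)<+\infty$, and the individual exponent $\beta(\Theta)$ is the supremum of the set of $\gamma>0$ with $\liminf_{t\to+\infty}t^\gamma\psi_\Theta(t)<+\infty$. Here $m=3$, $n=1$, $L_1(\mathbf{x})=\theta^1x_1+\theta^2x_2+\theta^3x_3$; in this case one always has $\alpha(\Theta)\ge 3$. *)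

(* Defs.v *)
From HB Require Import structures.
From mathcomp Require Import all_boot all_order all_algebra.
From mathcomp Require Import zify.
From mathcomp Require Import all_classical all_reals all_analysis.
Set Implicit Arguments.
Unset Strict Implicit.
Unset Printing Implicit Defensive.
Import Order.TTheory GRing.Theory Num.Theory.
Import numFieldNormedType.Exports.
Local Open Scope classical_set_scope.
Local Open Scope ring_scope.

Definition dist_int (R : realType) (t : R) : R :=
  inf [set `|t - k%:~R| | k in [set: int]].

(* Row [j] of [Theta] holds the coefficients of the form [L_j]: the entry
   [Theta j i] is theta_j^i. *)
Definition linform (R : realType) (n m : nat) (Theta : 'M[R]_(n, m))
    (j : 'I_n) (x : 'rV[int]_m) : R :=
  \sum_(i < m) Theta j i * (x 0 i)%:~R.

Definition height (m : nat) (x : 'rV[int]_m) : int :=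
  \big[Num.max/0]_(i < m) `|x 0 i|.

(* The maximum may start from 0 because [dist_int] is nonnegative. *)
Definition approx (R : realType) (n m : nat) (Theta : 'M[R]_(n, m))
    (x : 'rV[int]_m) : R :=
  \big[Num.max/0]_(j < n) dist_int (linform Theta j x).

(* For 1 <= t and 0 < m the set of admissible [x] is finite and nonempty, so
   this infimum is a minimum (lemma [psi_attained]). For t < 1 there is no
   admissible [x] and the value is +oo; this does not affect the limits at
   infinity below. *)
Definition psi (R : realType) (n m : nat) (Theta : 'M[R]_(n, m)) (t : R) :
    \bar R :=
  ereal_inf [set (approx Theta x)%:E |
    x in [set x : 'rV[int]_m | 0 < height x /\ (height x)%:~R <= t]].

Definition uniform_exponent (R : realType) (n m : nat)
    (Theta : 'M[R]_(n, m)) : \bar R :=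
  ereal_sup [set gamma%:E | gamma in [set gamma : R | 0 < gamma /\
    (limf_esup (fun t : R => (t `^ gamma)%:E * psi Theta t) (pinfty_nbhs R)
       < +oo)%E]].

Definition individual_exponent (R : realType) (n m : nat)
    (Theta : 'M[R]_(n, m)) : \bar R :=
  ereal_sup [set gamma%:E | gamma in [set gamma : R | 0 < gamma /\
    (limf_einf (fun t : R => (t `^ gamma)%:E * psi Theta t) (pinfty_nbhs R)
       < +oo)%E]].

Definition g2 (R : realType) (a : R) : R :=
  Num.sqrt (a + (a ^+ 2)^-1 - 7 / 4) + a^-1 - 1 / 2.

(* The uniform exponent may be infinite; [er_map g2] extends [g2] by its limit
   +oo at +oo. *)
Definition g2_ext (R : realType) (a : \bar R) : \bar R := er_map (@g2 R) a.

Lemma psi_attained (R : realType) (n m : nat) (Theta : 'M[R]_(n, m)) (t : R) :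
  (0 < m)%N -> 1 <= t ->
  exists x : 'rV[int]_m, [/\ 0 < height x, (height x)%:~R <= t,
    psi Theta t = (approx Theta x)%:E &
    forall y : 'rV[int]_m, 0 < height y -> (height y)%:~R <= t ->
      approx Theta x <= approx Theta y].
Proof.
move=> m0 t1.
pose D := [set x : 'rV[int]_m | 0 < height x /\ (height x)%:~R <= t].
pose k := `|Num.floor t|%N.
have tk : (Num.floor t) = k%:Z by rewrite /k gez0_abs // floor_ge0 (le_trans _ t1).
have le_h (x : 'rV[int]_m) i : `|x 0 i| <= height x.
  exact: (le_bigmax_cond 0 (fun i => `|x 0 i|)).
pose f (u : 'rV['I_(k + k).+1]_m) : 'rV[int]_m :=
  map_mx (fun z : 'I_(k + k).+1 => Posz z - Posz k) u.
have fD x : D x -> exists u, f u = x.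
  move=> [_ xt].
  exists (\row_i inord (absz (x 0 i + Posz k))); apply/rowP => i; rewrite !mxE.
  have : `|x 0 i| <= Posz k.
    by rewrite (le_trans (le_h x i)) // -tk floor_ge_int.
  rewrite ler_norml => /andP[? ?]; rewrite inordK; lia.
have [x1 Dx1] : D !=set0.
  exists (const_mx 1); rewrite /D /=.
  have -> : height (const_mx 1 : 'rV[int]_m) = 1.
    apply/eqP; rewrite eq_le; apply/andP; split.
      by apply: bigmax_le => // i _; rewrite mxE.
    by have := le_h (const_mx 1) (Ordinal m0); rewrite mxE.
  by [].
have [u1 fu1] := fD _ Dx1.
have Pu1 : `[< D (f u1) >] by apply/asboolP; rewrite fu1.
pose u := [arg min_(v < u1 | `[< D (f v) >]) approx Theta (f v)]%O.
have [Du umin] : D (f u) /\ forall y, D y -> approx Theta (f u) <= approx Theta y.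
  rewrite /u; case: arg_minP => // v /asboolP Dv vmin; split=> // y Dy.
  have [w fw] := fD _ Dy; rewrite -fw; apply: vmin.
  by apply/asboolP; rewrite fw.
exists (f u); have [h0 ht] := Du; split => //.
  apply/eqP; rewrite eq_le; apply/andP; split.
    by apply: ereal_inf_lbound; exists (f u).
  by apply: le_ereal_inf_tmp => _ [y Dy <-]; rewrite lee_fin umin.
by move=> y y0 yt; apply: umin.
Qed.

(* Main.v *)
(* Minimal points Z_0, Z_1, ... of the form L = x_0 + theta . x have decreasing
   values zeta_i = |L(Z_i)| and increasing heights X_i.  Suppose
   zeta_i << X_(i+1)^(-gam) and zeta_i >> X_i^(-gam g) with
   g^2 + g + 1 < gam; then also X_(i+1) << X_i^g.

   The minors L(Z_i) x_l(Z_(i+1)) - L(Z_(i+1)) x_l(Z_i) have maximum comparable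
   to zeta_i X_(i+1), and do not decrease in absolute value as long as the
   minimal points stay in one plane.  Choose independent Z_k, Z_(k+1), Z_(k+2)
   and the first Z_j outside their span, with j - k minimal: then
   Z_(k+1), ..., Z_(j-1) lie in one plane, whence
     zeta_(k+1) X_(k+2) << zeta_(j-2) X_(j-1) << X_(j-1)^(1-gam),
   while the nonzero integer det(Z_k, Z_(k+1), Z_(k+2), Z_j) gives
     1 << zeta_k X_(k+1) X_(k+2) X_j.
   Taking logarithms these inequalities bound
   (gam - 1)(gam - 1 - g - g^2) ln X_(k+1), which is absurd.  For a linear form
   the minimal points may also all lie in a fixed hyperplane from some point
   on; there the determinant is replaced by a three-dimensional one and even
   1 << zeta_k X_(k+1) X_(k+2).

   Hence beta >= alpha G with G^2 + G + 1 = alpha, and G >= g_2(alpha) for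
   alpha >= 3.  For 1 <= alpha <= 3 one has g_2(alpha) <= 1, so beta >= alpha
   suffices and only the trivial bound alpha >= 1 is needed. *)
Require Import Defs.
From mathcomp Require Import all_boot all_order all_algebra perm.
From mathcomp Require Import ring lra zify.
From mathcomp Require Import all_classical all_reals all_analysis.
Import Order.TTheory GRing.Theory Num.Theory.
Import numFieldNormedType.Exports.
Set Implicit Arguments.
Unset Strict Implicit.
Unset Printing Implicit Defensive.
Local Open Scope classical_set_scope.
Local Open Scope ring_scope.

(* A point x of the lattice is encoded by the row (L(x), x_1, x_2, x_3). *)
Definition hgt (R : realType) (v : 'rV[R]_4) : R :=
  \big[Num.max/0]_(l < 4 | l != 0) `|v 0 l|.

Definition lform (R : realType) (v : 'rV[R]_4) : R := `|v 0 0|.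

Definition lattice (R : realType) (U : 'M[R]_4) (v : 'rV[R]_4) : Prop :=
  exists z : 'rV[int]_4, v = map_mx intr z *m U.

Definition wedge (R : realType) (u v : 'rV[R]_4) (l : 'I_4) : R :=
  u 0 0 * v 0 l - v 0 0 * u 0 l.

Definition stack4 (R : realType) (p u v w : 'rV[R]_4) : 'M[R]_4 :=
  \matrix_(i < 4) [:: p; u; v; w]`_i.

(** * Heights and forms of vectors *)

Lemma hgt_ge (R : realType) (v : 'rV[R]_4) l : l != 0 -> `|v 0 l| <= hgt v.
Proof. by move=> l0; apply: (le_bigmax_cond 0 (fun i => `|v 0 i|)). Qed.

Lemma hgt_ge0 (R : realType) (v : 'rV[R]_4) : 0 <= hgt v.
Proof. exact: le_trans (hgt_ge v (isT : ord_max != 0 :> 'I_4)). Qed.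

Lemma hgt_le (R : realType) (v : 'rV[R]_4) M :
  0 <= M -> (forall l, l != 0 -> `|v 0 l| <= M) -> hgt v <= M.
Proof. by move=> M0 H; apply: bigmax_le. Qed.

Lemma hgt_attained (R : realType) (v : 'rV[R]_4) :
  exists2 l, l != 0 & `|v 0 l| = hgt v.
Proof.
pose l := [arg max_(i > (ord_max : 'I_4) | i != 0) `|v 0 i|]%O.
have [l0 lP] : l != 0 /\ forall i, i != 0 -> `|v 0 i| <= `|v 0 l|.
  by rewrite /l; case: arg_maxP.
by exists l => //; apply/eqP; rewrite eq_le hgt_ge // hgt_le.
Qed.

Lemma hgt_comb (R : realType) (a b : R) (u v : 'rV[R]_4) :
  hgt (a *: u + b *: v) <= `|a| * hgt u + `|b| * hgt v.
Proof.
apply: hgt_le => [|l l0]; first by rewrite addr_ge0 // mulr_ge0 // hgt_ge0.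
rewrite !mxE (le_trans (ler_normD _ _)) // !normrM.
by rewrite lerD // ler_wpM2l // hgt_ge.
Qed.

Lemma form_comb (R : realType) (a b : R) (u v : 'rV[R]_4) :
  lform (a *: u + b *: v) <= `|a| * lform u + `|b| * lform v.
Proof. by rewrite /lform !mxE (le_trans (ler_normD _ _)) // !normrM. Qed.

(** * Lattice points and their determinants *)

Lemma lattice_comb (R : realType) (U : 'M[R]_4) (m n : int) u v :
  lattice U u -> lattice U v ->
  lattice U (m%:~R *: u + n%:~R *: v).
Proof.
move=> [x ->] [y ->]; exists (m *: x + n *: y).
by rewrite !scalemxAl -mulmxDl; congr (_ *m _); apply/rowP => i; rewrite !mxE rmorphD !rmorphM.
Qed.

(** The rows have integer coordinates in a basis of determinant 1, so [\det A] is an integer. *)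
Lemma lattice_det (R : realType) (U A : 'M[R]_4) :
  \det U = 1 -> (forall i, lattice U (row i A)) -> \det A != 0 ->
  1 <= `|\det A|.
Proof.
move=> U1 /(_ _)/cid H.
have -> : A = map_mx intr (\matrix_i sval (H i)) *m U.
  apply/row_matrixP => i; rewrite row_mul (svalP (H i)); congr (_ *m _).
  by apply/rowP => j; rewrite !mxE.
rewrite det_mulmx U1 mulr1 det_map_mx intr_eq0 -intr_norm => d0.
by rewrite -[1]/(1%:~R) ler_int; move: (\det _) d0 => d; lia.
Qed.

(** Each of the 24 Leibniz products takes one entry from column 0, bounded by some [z i], and one
    entry from another column in each row [j != i]. *)
Lemma det_bound (R : realType) (A : 'M[R]_4) (z x : 'I_4 -> R) (B : R) :
  (forall i, `|A i 0| <= z i) ->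
  (forall i l, l != 0 -> `|A i l| <= x i) ->
  (forall i, z i * \prod_(j | j != i) x j <= B) ->
  `|\det A| <= 24 * B.
Proof.
move=> Az Ax zx; rewrite (le_trans (ler_norm_sum _ _ _)) //.
have -> : 24 * B = \sum_(s : 'S_4) B.
  by rewrite sumr_const card_Sn -[(4`!)%N]/24%N mulr_natl.
apply: ler_sum => s _; rewrite normrMsign normr_prod.
apply: le_trans (zx ((s^-1)%g 0)); rewrite (bigD1 ((s^-1)%g 0)) //= permKV.
rewrite ler_pM //; first exact: prodr_ge0.
apply: ler_prod => i is0; rewrite normr_ge0 Ax //.
by apply: contra is0 => /eqP <-; rewrite permK.
Qed.

Lemma rank_stack3 (R : realType) (p u v : 'rV[R]_4) :
  (\rank (p + u + v)%MS <= 3)%N.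
Proof.
rewrite (leq_trans (mxrank_adds_leqif _ _)) //.
have := mxrank_adds_leqif p u; have := rank_leq_row p.
have := rank_leq_row u; have := rank_leq_row v => a b c [d _]; lia.
Qed.

Lemma mulmx_stack4 (R : realType) (p u v w c : 'rV[R]_4) :
  c *m stack4 p u v w =
    c 0 0 *: p + c 0 1 *: u + c 0 2 *: v + c 0 3 *: w.
Proof.
by apply/rowP => j; rewrite !mxE !big_ord_recl big_ord0 !mxE /= addr0 !addrA;
  do !congr (_ + _); congr (c _ _ * _); apply: val_inj.
Qed.

(** The substitution is left multiplication by a triangular matrix with diagonal 1, 1, 1,
    [c 0 3]. *)
Lemma det_stack4_last (R : realType) (p u v w c : 'rV[R]_4) :
  \det (stack4 p u v (c *m stack4 p u v w)) =
    c 0 3 * \det (stack4 p u v w).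
Proof.
pose E : 'M[R]_4 := \matrix_i (if i == 3 then c else row i 1%:M).
have -> : stack4 p u v (c *m stack4 p u v w) = E *m stack4 p u v w.
  apply/row_matrixP => i; rewrite row_mul !rowK.
  case: eqP => [->//|/eqP i3]; rewrite -row_mul mul1mx rowK.
  by case: i i3 => [[|[|[|[|]]]]].
rewrite det_mulmx det_trig ?big_ord_recl ?big_ord0; last first.
  apply/is_trig_mxP => i j ij; rewrite !mxE; case: eqP => [i3|_].
    by move: ij (ltn_ord j); rewrite i3 /=; lia.
  by rewrite !mxE; case: eqP ij => // ->; rewrite ltnn.
rewrite !mxE /= !mul1r mulr1; congr (c _ _ * _); exact: val_inj.
Qed.

(** * Sequences of minimal points *)

Record minimal_seq (R : realType) (U : 'M[R]_4) (Z : nat -> 'rV[R]_4) : Prop :=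
  MinimalSeq {
    ms_lattice : forall i, lattice U (Z i);
    ms_form_gt0 : forall i, 0 < lform (Z i);
    ms_form_decr : forall i, lform (Z i.+1) < lform (Z i);
    ms_hgt_gt0 : forall i, 0 < hgt (Z i);
    ms_hgt_incr : forall i, hgt (Z i) < hgt (Z i.+1);
    ms_minimal : forall i v, lattice U v -> lform v < lform (Z i) ->
      hgt v < hgt (Z i.+1) -> v = 0
  }.

Lemma wedge_le (R : realType) (U : 'M[R]_4) Z (ms : minimal_seq U Z) i l :
  l != 0 -> `|wedge (Z i) (Z i.+1) l| <= 2 * lform (Z i) * hgt (Z i.+1).
Proof.
move=> l0; rewrite (le_trans (ler_normB _ _)) // !normrM.
have := ms_form_decr ms i; have := ms_hgt_incr ms i.
have := hgt_ge (Z i) l0; have := hgt_ge (Z i.+1) l0.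
rewrite -[`|Z i 0 0|]/(lform _) -[`|Z i.+1 0 0|]/(lform _) => a b c d.
have -> : 2 * lform (Z i) * hgt (Z i.+1)
  = lform (Z i) * hgt (Z i.+1) + lform (Z i) * hgt (Z i.+1) by ring.
rewrite lerD // ler_pM // ?normr_ge0 //; first exact: ltW.
exact: le_trans b (ltW c).
Qed.

Lemma align_sign (R : realType) (x y : R) : `|y| < `|x| ->
  exists2 s : int, `|s%:~R : R| = 1 & `|x - s%:~R * y| = `|x| - `|y|.
Proof.
have [x0|x0] := ltP x 0; have [y0|y0] := ltP y 0;
  rewrite ?(ltr0_norm x0) ?(ltr0_norm y0) ?(ger0_norm x0) ?(ger0_norm y0) => yx;
  [exists 1|exists (-1)|exists (-1)|exists 1]; rewrite ?intrN ?normrN ?normr1 //.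
- by rewrite ler0_norm; lra.
- by rewrite ler0_norm; lra.
- by rewrite ger0_norm; lra.
- by rewrite ger0_norm; lra.
Qed.

(** If the form of [v = Z i.+1] is at most half that of [u = Z i], the coordinate attaining [hgt v]
    works. Otherwise [y = s v - u] has a form below half that of [u], minimality gives
    [hgt v <= hgt y], and [wedge u y] is [wedge u v] up to sign; the coordinate attaining [hgt y]
    works. *)
Lemma wedge_ge (R : realType) (U : 'M[R]_4) Z (ms : minimal_seq U Z) i :
  exists2 l, l != 0 &
    lform (Z i) * hgt (Z i.+1) <= 2 * `|wedge (Z i) (Z i.+1) l|.
Proof.
set u := Z i; set v := Z i.+1.
have fv0 : 0 < lform v := ms_form_gt0 ms i.+1.
have fvu : lform v < lform u := ms_form_decr ms i.
have hu0 : 0 < hgt u := ms_hgt_gt0 ms i.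
have huv : hgt u < hgt v := ms_hgt_incr ms i.
have [fvs|fvb] := leP (2 * lform v) (lform u).
  have [l l0 lv] := hgt_attained v; exists l => //.
  have := lerB_dist (u 0 0 * v 0 l) (v 0 0 * u 0 l).
  rewrite !normrM lv -/(lform u) -/(lform v) -/(wedge u v l) => H.
  have : lform v * `|u 0 l| <= lform v * hgt v.
    by rewrite ler_wpM2l ?(ltW fv0) // (le_trans (hgt_ge u l0)) // ltW.
  by nra.
have [s s1 fs] := align_sign fvu.
rewrite -/(lform u) -/(lform v) in fs.
pose y := (-1)%:~R *: u + s%:~R *: v.
have yl : lattice U y by apply: lattice_comb; apply: ms_lattice ms _.
have fy : lform y = lform u - lform v.
  by rewrite -fs /lform /y !mxE -normrN; congr `|_|; rewrite intrN; ring.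
have hy : hgt v <= hgt y.
  rewrite leNgt; apply/negP => /(ms_minimal ms yl) y0.
  have {y0} : y = 0 by apply: y0; rewrite fy -/u; lra.
  move=> y0.
  (* If [y = 0], the coordinates of [u] and [v] agree up to sign. *)
  have : hgt v <= hgt u; last by rewrite leNgt huv.
  apply: hgt_le => [|l l0]; first exact: ltW.
  have /rowP/(_ l) := y0; rewrite !mxE intrN mulN1r => /eqP.
  rewrite addrC subr_eq0 => /eqP vu.
  by rewrite (le_trans _ (hgt_ge u l0)) // -vu normrM s1 mul1r.
have [l l0 ly] := hgt_attained y; exists l => //.
have -> : `|wedge u v l| = `|u 0 0 * y 0 l + (u 0 0 - s%:~R * v 0 0) * u 0 l|.
  rewrite -[LHS]mul1r -{1}s1 -normrM /wedge /y !mxE intrN; congr `|_|; ring.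
have := lerB_dist (u 0 0 * y 0 l) (- ((u 0 0 - s%:~R * v 0 0) * u 0 l)).
rewrite opprK normrN !normrM fs ly -/(lform u) => H.
have : lform u * hgt v <= lform u * hgt y by rewrite ler_wpM2l // ltW // (lt_trans fv0).
have : (lform u - lform v) * `|u 0 l| <= (lform u / 2) * hgt v.
  rewrite ler_pM //; [lra | lra|].
  by rewrite (le_trans (hgt_ge u l0)) // ltW.
by lra.
Qed.

(** Some minor of the pair is nonzero by [wedge_ge]; the rest is Cramer's rule. *)
Lemma consecutive_free (R : realType) (U : 'M[R]_4) Z (ms : minimal_seq U Z)
    i a b : a *: Z i + b *: Z i.+1 = 0 -> a = 0 /\ b = 0.
Proof.
move=> ab; have [l l0 H] := wedge_ge ms i.
have W : wedge (Z i) (Z i.+1) l != 0.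
  rewrite -normr_gt0 -(pmulr_rgt0 _ (ltr0n R 2)) (lt_le_trans _ H) //.
  by rewrite mulr_gt0 ?(ms_form_gt0 ms) ?(ms_hgt_gt0 ms).
have /rowP ab' := ab; have := ab' 0; have := ab' l; rewrite !mxE => El E0.
split; apply: (mulIf W); rewrite mul0r /wedge.
  have -> : a * (Z i 0 0 * Z i.+1 0 l - Z i.+1 0 0 * Z i 0 l) =
    (a * Z i 0 0 + b * Z i.+1 0 0) * Z i.+1 0 l -
    (a * Z i 0 l + b * Z i.+1 0 l) * Z i.+1 0 0 by ring.
  by rewrite El E0 !mul0r subr0.
have -> : b * (Z i 0 0 * Z i.+1 0 l - Z i.+1 0 0 * Z i 0 l) =
  (a * Z i 0 l + b * Z i.+1 0 l) * Z i 0 0 -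
  (a * Z i 0 0 + b * Z i.+1 0 0) * Z i 0 l by ring.
by rewrite El E0 !mul0r subr0.
Qed.

Lemma near_int (R : realType) (a : R) : exists n : int, `|a - n%:~R| <= 2^-1.
Proof.
exists (Num.floor (a + 2^-1)).
have /andP[] := floor_itv (a + 2^-1); rewrite intrD ler_norml => ? ?.
by apply/andP; split; lra.
Qed.

(* Two consecutive minimal points lform a basis of the lattice in their plane,
   so [a] is a nonzero integer. *)
Lemma coplanar_coef (R : realType) (U : 'M[R]_4) Z (ms : minimal_seq U Z)
    i a b : Z i.+2 = a *: Z i + b *: Z i.+1 -> 1 <= `|a|.
Proof.
move=> E; have [n an] := near_int a; have [m bm] := near_int b.
(* Rounding leaves a lattice point with coefficients at most 1/2 in absolute value, too small to be
   nonzero by minimality. *)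
pose y := (a - n%:~R) *: Z i + (b - m%:~R) *: Z i.+1.
have y0 : y = 0.
  apply: (ms_minimal ms (i := i)).
  - have -> : y = 1%:~R *: Z i.+2 +
      (-1)%:~R *: (n%:~R *: Z i + m%:~R *: Z i.+1).
      by apply/rowP => l; rewrite E !mxE intrN; ring.
    by apply: lattice_comb; [|apply: lattice_comb]; apply: ms_lattice ms _.
  - apply: le_lt_trans (form_comb _ _ _ _) _.
    have := ms_form_decr ms i; have := ms_form_gt0 ms i.+1; nra.
  - apply: le_lt_trans (hgt_comb _ _ _ _) _.
    have := ms_hgt_incr ms i; have := ms_hgt_gt0 ms i; nra.
have [/eqP] := consecutive_free ms y0; rewrite subr_eq0 => /eqP -> _.
(* If [n = 0], then [Z i.+2] would be proportional to [Z i.+1]. *)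
have : n != 0.
  apply/eqP => n0.
  have : b *: Z i.+1 + (-1) *: Z i.+2 = 0.
    have /eqP := (consecutive_free ms y0).1; rewrite subr_eq0 n0 => /eqP a0.
    by rewrite E a0; apply/rowP => l; rewrite !mxE; ring.
  by move/(consecutive_free ms) => [_ /eqP]; rewrite oppr_eq0 oner_eq0.
by rewrite -intr_norm -[1]/(1%:~R) ler_int; lia.
Qed.

Lemma wedge_coplanar (R : realType) (u v w : 'rV[R]_4) a b l :
  w = a *: u + b *: v -> wedge v w l = - a * wedge u v l.
Proof. by move=> ->; rewrite /wedge !mxE; ring. Qed.

(** * Planes and hyperplanes spanned by minimal points *)

Definition coplanar (R : realType) (Z : nat -> 'rV[R]_4) (i : nat) : bool :=
  (Z i.+2 <= Z i + Z i.+1)%MS.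

Definition span3 (R : realType) (Z : nat -> 'rV[R]_4) (i : nat) : 'M[R]_4 :=
  (Z i + Z i.+1 + Z i.+2)%MS.

Lemma sub_span2 (R : realType) (u v w : 'rV[R]_4) :
  (w <= u + v)%MS -> exists a b, w = a *: u + b *: v.
Proof.
move=> /sub_addsmxP[[a b]] /= ->; exists (a 0 0), (b 0 0).
by rewrite (mx11_scalar a) (mx11_scalar b) !mul_scalar_mx !mxE.
Qed.

(** Each coplanar step multiplies the minor by some [- a] with [1 <= |a|]. *)
Lemma wedge_run (R : realType) (U : 'M[R]_4) Z (ms : minimal_seq U Z) i n l :
  (forall j, (i <= j < i + n)%N -> coplanar Z j) ->
  `|wedge (Z i) (Z i.+1) l| <= `|wedge (Z (i + n)%N) (Z (i + n).+1) l|.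
Proof.
elim: n => [|n IHn] H; first by rewrite addn0.
apply: le_trans (IHn _) _ => [j /andP[ij jn]|]; first by apply: H; lia.
have /sub_span2[a [b E]] : coplanar Z (i + n) by apply: H; lia.
rewrite addnS (wedge_coplanar _ E) normrM normrN ler_peMl //.
exact: coplanar_coef ms _ _ _ E.
Qed.

(** The factor 4 is a 2 from [wedge_ge] times a 2 from [wedge_le]. *)
Lemma coplanar_run (R : realType) (U : 'M[R]_4) Z (ms : minimal_seq U Z) i n :
  (forall j, (i <= j < i + n)%N -> coplanar Z j) ->
  lform (Z i) * hgt (Z i.+1) <= 4 * (lform (Z (i + n)%N) * hgt (Z (i + n).+1)).
Proof.
move=> H; have [l l0 lo] := wedge_ge ms i.
have := wedge_run ms l H; have := wedge_le ms (i + n) l0; lra.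
Qed.

(** On an endless coplanar run the products would stay at least a quarter of their first value. *)
Lemma noncoplanar_cofinal (R : realType) (U : 'M[R]_4) Z
    (ms : minimal_seq U Z) :
  (forall e N, 0 < e -> exists2 j, (N <= j)%N & lform (Z j) * hgt (Z j.+1) < e) ->
  forall N, exists2 k, (N <= k)%N & ~~ coplanar Z k.
Proof.
move=> small N; apply: contrapT => nex.
have cop j : (N <= j)%N -> coplanar Z j.
  by move=> Nj; apply: contrapT => /negP cj; apply: nex; exists j.
have e0 : 0 < lform (Z N) * hgt (Z N.+1) / 4.
  by rewrite divr_gt0 // mulr_gt0 ?(ms_form_gt0 ms) ?(ms_hgt_gt0 ms).
have [j Nj] := small _ N e0.
have := @coplanar_run _ _ _ ms N (j - N) (fun i Hi => cop i (proj1 (andP Hi))).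
by rewrite subnKC //; lra.
Qed.

(** In a relation between the rows the coefficients vanish from the last one backwards: first that
    of [w], then that of [Z k.+2], and the other two by [consecutive_free]. *)
Lemma det_span3 (R : realType) (U : 'M[R]_4) Z (ms : minimal_seq U Z) k w :
  ~~ coplanar Z k -> ~~ (w <= span3 Z k)%MS ->
  \det (stack4 (Z k) (Z k.+1) (Z k.+2) w) != 0.
Proof.
move=> ck wk; apply/det0P => -[c c0]; rewrite mulmx_stack4 => E.
have sub1 : (Z k <= Z k + Z k.+1)%MS := addsmxSl _ _.
have sub2 : (Z k.+1 <= Z k + Z k.+1)%MS := addsmxSr _ _.
have sub3 : (Z k.+2 <= span3 Z k)%MS := addsmxSr _ _.
have sub12 : (Z k + Z k.+1 <= span3 Z k)%MS := addsmxSl _ _.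
have w0 : c 0 3 = 0.
  apply/eqP; apply: contraNT wk => c3.
  have -> : w = (- (c 0 3)^-1) *: (c 0 0 *: Z k + c 0 1 *: Z k.+1 + c 0 2 *: Z k.+2).
    move/eqP: E; rewrite addr_eq0 => /eqP ->.
    by rewrite scaleNr scalerN opprK scalerA mulVf // scale1r.
  rewrite scalemx_sub // !addmx_sub // scalemx_sub //.
    exact: submx_trans sub12.
  exact: submx_trans sub12.
move: E; rewrite w0 scale0r addr0 => E.
have v0 : c 0 2 = 0.
  apply/eqP; apply: contraNT ck => c2; rewrite /coplanar.
  have -> : Z k.+2 = (- (c 0 2)^-1) *: (c 0 0 *: Z k + c 0 1 *: Z k.+1).
    move/eqP: E; rewrite addr_eq0 => /eqP ->.
    by rewrite scaleNr scalerN opprK scalerA mulVf // scale1r.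
  by rewrite scalemx_sub // !addmx_sub // scalemx_sub.
move: E; rewrite v0 scale0r addr0 => /(consecutive_free ms)[a0 b0].
move/eqP: c0; apply; apply/rowP => i; rewrite mxE.
by case: i => [[|[|[|[|//]]]] Hi];
  [apply: etrans a0|apply: etrans b0|apply: etrans v0|apply: etrans w0];
  congr (c _ _); apply: val_inj.
Qed.

Lemma span3_sub (R : realType) (Z : nat -> 'rV[R]_4) k (H : 'M[R]_4) :
  (Z k <= H)%MS -> (Z k.+1 <= H)%MS -> (Z k.+2 <= H)%MS -> (span3 Z k <= H)%MS.
Proof. by move=> *; rewrite !addsmx_sub; apply/andP; split => //; apply/andP. Qed.

Lemma sub_span3 (R : realType) (Z : nat -> 'rV[R]_4) k i :
  (k <= i <= k.+2)%N -> (Z i <= span3 Z k)%MS.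
Proof.
move=> ki; have : (i == k) || (i == k.+1) || (i == k.+2) by lia.
move=> /orP[/orP[]|] /eqP ->; rewrite /span3.
- exact: submx_trans (addsmxSl _ _) (addsmxSl _ _).
- exact: submx_trans (addsmxSr _ _) (addsmxSl _ _).
- exact: addsmxSr.
Qed.

(** Descent on [j - k]: replace [j] by an earlier point outside the span, or [k] by a later
    noncoplanar index [i]. In the second case [span3 Z i] lies in [span3 Z k], so [Z j] is still
    outside. *)
Lemma minimal_escape (R : realType) (Z : nat -> 'rV[R]_4) N k j :
  (N <= k <= j)%N -> ~~ coplanar Z k -> ~~ (Z j <= span3 Z k)%MS ->
  exists k' j', [/\ (N <= k')%N, (k'.+3 <= j')%N, ~~ coplanar Z k',
    ~~ (Z j' <= span3 Z k')%MS &
    forall i, (k' < i)%N -> (i.+2 < j')%N -> coplanar Z i].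
Proof.
have [d] := ubnP (j - k)%N; elim: d k j => // d IHd k j jkd Nkj ck jk.
have kj3 : (k.+3 <= j)%N.
  by rewrite ltnNge; apply: contra jk => jk; apply: sub_span3; lia.
have [[j' /and3P[kj' j'j j'k]]|inH] :=
    pselect (exists j', [&& k <= j', j' < j & ~~ (Z j' <= span3 Z k)%MS]%N).
  by apply: IHd ck j'k; lia.
have {}inH i : (k <= i < j)%N -> (Z i <= span3 Z k)%MS.
  by move=> ij; apply: contrapT => /negP iH; apply: inH; exists i; lia.
have [[i /and3P[ki ij ci]]|all_cop] :=
    pselect (exists i, [&& k < i, i.+2 < j & ~~ coplanar Z i]%N).
  have ji : ~~ (Z j <= span3 Z i)%MS.
    apply: contra jk => ji; apply: submx_trans ji _.
    by apply: span3_sub; apply: inH; lia.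
  by apply: IHd ci ji; lia.
exists k, j; split => //; first by lia.
by move=> i ki ij; apply: contrapT => /negP ci; apply: all_cop; exists i; lia.
Qed.

(** The hypotheses make the products with the form of [p] dominant. The one on [w] compares ratios,
    so that it also admits a vector of zero form and small height. *)
Lemma det_stack4_le (R : realType) (p u v w : 'rV[R]_4) :
  lform u <= lform p -> lform v <= lform p -> hgt p <= hgt u -> hgt p <= hgt v ->
  lform w * hgt p <= lform p * hgt w ->
  `|\det (stack4 p u v w)| <= 24 * (lform p * hgt u * hgt v * hgt w).
Proof.
move=> up vp pu pv wp.
pose r (i : 'I_4) := [:: p; u; v; w]`_i.
apply: (det_bound (z := fun i => lform (r i)) (x := fun i => hgt (r i))).
- by move=> i; rewrite mxE.
- by move=> i l l0; rewrite mxE hgt_ge.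
have := hgt_ge0 p; have := hgt_ge0 u; have := hgt_ge0 v; have := hgt_ge0 w.
have := normr_ge0 (p 0 0); rewrite -/(lform p) => p0 w0 v0 u0 hp0.
have pw : 0 <= hgt p * hgt w by rewrite mulr_ge0.
have uv : 0 <= hgt u * hgt v by rewrite mulr_ge0.
have vw : 0 <= hgt v * hgt w by rewrite mulr_ge0.
have uw : 0 <= hgt u * hgt w by rewrite mulr_ge0.
move=> i; rewrite big_mkcond !big_ord_recl big_ord0 /=.
case: i => [[|[|[|[|//]]]] Hi]; rewrite /r /= ?mul1r ?mulr1.
- by rewrite !mulrA.
- have -> : lform p * hgt u * hgt v * hgt w = (lform p * hgt u) * (hgt v * hgt w) by ring.
  by rewrite mulrA ler_wpM2r // ler_pM // normr_ge0.
- have -> : lform p * hgt u * hgt v * hgt w = (lform p * hgt v) * (hgt u * hgt w) by ring.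
  have -> : lform v * (hgt p * (hgt u * hgt w)) = (lform v * hgt p) * (hgt u * hgt w) by ring.
  by rewrite ler_wpM2r // ler_pM // normr_ge0.
- have -> : lform p * hgt u * hgt v * hgt w = (lform p * hgt w) * (hgt u * hgt v) by ring.
  by rewrite mulrA ler_wpM2r.
Qed.

(** * The case of a hyperplane containing all late minimal points *)

Lemma lattice_notin (R : realType) (U H : 'M[R]_4) :
  \det U = 1 -> (\rank H <= 3)%N -> exists2 v, lattice U v & ~~ (v <= H)%MS.
Proof.
move=> U1 rH; apply: contrapT => nex.
have UH : (U <= H)%MS.
  apply/row_subP => i; apply: contrapT => /negP iH; apply: nex.
  exists (row i U) => //; exists (row i 1%:M).
  by rewrite map_row map_scalar_mx rmorph1 -row_mul mul1mx.
have := mxrankS UH; rewrite mxrank_unit ?unitmxE ?U1 ?unitr1 //.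
by move=> r4; have := leq_trans r4 rH.
Qed.

(** Some unit vector other than [delta_mx 0 0] serves: if [H] contained them all, [v] with its
    nonzero form would bring in the remaining one. *)
Lemma kernel_notin (R : realType) (H : 'M[R]_4) (v : 'rV[R]_4) :
  (\rank H <= 3)%N -> (v <= H)%MS -> 0 < lform v ->
  exists e : 'rV[R]_4, [/\ lform e = 0, hgt e <= 1 & ~~ (e <= H)%MS].
Proof.
move=> rH vH v0; apply: contrapT => nex.
have dH (l : 'I_4) : l != 0 -> ((delta_mx 0 l : 'rV[R]_4) <= H)%MS.
  move=> l0; apply: contrapT => /negP lH; apply: nex; exists (delta_mx 0 l).
  split => //; first by rewrite /lform mxE eqxx eq_sym (negbTE l0) normr0.
  by apply: hgt_le => // i _; rewrite mxE; case: (_ && _); rewrite ?normr0 ?normr1 ?ler01.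
have d0H : ((delta_mx 0 0 : 'rV[R]_4) <= H)%MS.
  have v00 : v 0 0 != 0 by rewrite -normr_gt0.
  have -> : delta_mx 0 0 =
      (v 0 0)^-1 *: (v - \sum_(l | l != 0) v 0 l *: delta_mx 0 l) :> 'rV_4.
    have := row_sum_delta v; rewrite (bigD1 (0 : 'I_4)) //= => vE.
    by rewrite {2}vE addrK scalerA mulVf // scale1r.
  rewrite scalemx_sub // addmx_sub // eqmx_opp summx_sub // => l l0.
  by rewrite scalemx_sub // dH.
have : (1%:M <= H)%MS.
  apply/row_subP => i; rewrite row1.
  by have [->//|/dH] := eqVneq i 0.
by move/mxrankS; rewrite mxrank1 => r4; have := leq_trans r4 rH.
Qed.

(* The functional [w |-> det (Z k, Z k.+1, Z k.+2, w)] has kernel [H], so its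
   values at [e] and at the lattice vector [e'] have a ratio [tau] which does
   not depend on [k]; and the latter value is a nonzero integer. *)
Lemma hyperplane_gap (R : realType) (U : 'M[R]_4) Z (ms : minimal_seq U Z) N k0 :
  \det U = 1 -> (N <= k0)%N -> ~~ coplanar Z k0 ->
  (forall j, (N <= j)%N -> (Z j <= span3 Z k0)%MS) ->
  exists2 tau, 0 < tau & forall k, (N <= k)%N -> ~~ coplanar Z k ->
    tau <= lform (Z k) * hgt (Z k.+1) * hgt (Z k.+2).
Proof.
move=> U1 Nk0 ck0 inH; set H := span3 Z k0 in inH.
have rH : (\rank H <= 3)%N := rank_stack3 _ _ _.
have [e' le' e'H] := lattice_notin U1 rH.
have [e [e0 e1 eH]] := kernel_notin rH (inH _ Nk0) (ms_form_gt0 ms k0).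
(* [tau] is the coordinate of [e] along [e'] in the basis formed by the three minimal points and
   [e']. *)
have expand k : (N <= k)%N -> ~~ coplanar Z k ->
    exists tau, (e - tau *: e' <= H)%MS /\
      \det (stack4 (Z k) (Z k.+1) (Z k.+2) e) =
      tau * \det (stack4 (Z k) (Z k.+1) (Z k.+2) e') /\
      \det (stack4 (Z k) (Z k.+1) (Z k.+2) e') != 0.
  move=> Nk ck.
  have e'k : ~~ (e' <= span3 Z k)%MS.
    apply: contra e'H => e'k; apply: submx_trans e'k _.
    by apply: span3_sub; apply: inH; lia.
  have d0 := det_span3 ms ck e'k.
  set A := stack4 _ _ _ e' in d0 *.
  have uA : A \in unitmx by rewrite unitmxE unitfE.
  have eE : e = (e *m invmx A) *m A by rewrite mulmxKV.
  set c := e *m invmx A in eE.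
  exists (c 0 3); split; last by rewrite {1}eE det_stack4_last.
  rewrite eE mulmx_stack4 addrK !addmx_sub // scalemx_sub // inH //; lia.
have [tau [etau _]] := expand _ Nk0 ck0.
have tau0 : tau != 0.
  by apply: contraNneq eH => tau0; move: etau; rewrite tau0 scale0r subr0.
(* 24 comes from [det_stack4_le], where [hgt e <= 1] removes the last factor. *)
exists (`|tau| / 24) => [|k Nk ck]; first by rewrite divr_gt0 // normr_gt0.
have [tau' [etau' [dE d0]]] := expand _ Nk ck.
(* Two different ratios would put a nonzero multiple of [e'] into [H]. *)
have tt : tau' = tau.
  apply/eqP; rewrite -subr_eq0; apply: contraNT e'H => tt.
  have -> : e' = (tau' - tau)^-1 *: ((e - tau *: e') - (e - tau' *: e')).
    have -> : (e - tau *: e') - (e - tau' *: e') = (tau' - tau) *: e'.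
      by apply/rowP => i; rewrite !mxE; ring.
    by rewrite scalerA mulVf // scale1r.
  by rewrite scalemx_sub // addmx_sub // eqmx_opp.
have d1 : 1 <= `|\det (stack4 (Z k) (Z k.+1) (Z k.+2) e')|.
  apply: lattice_det U1 _ d0 => i; rewrite rowK.
  by case: i => [[|[|[|[|//]]]] Hi] //=; apply: ms_lattice ms _.
have wp : lform e * hgt (Z k) <= lform (Z k) * hgt e.
  by rewrite e0 mul0r mulr_ge0 ?hgt_ge0 // ltW // (ms_form_gt0 ms).
have := det_stack4_le (ltW (ms_form_decr ms k))
  (ltW (lt_trans (ms_form_decr ms k.+1) (ms_form_decr ms k)))
  (ltW (ms_hgt_incr ms k))
  (ltW (lt_trans (ms_hgt_incr ms k) (ms_hgt_incr ms k.+1))) wp.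
rewrite dE tt normrM.
set P := _ * hgt _ * hgt (Z k.+2) => bound.
have P0 : 0 <= P by rewrite !mulr_ge0 ?hgt_ge0 ?normr_ge0.
have : P * hgt e <= P by rewrite ler_piMr.
have : `|tau| <= `|tau| * `|\det (stack4 (Z k) (Z k.+1) (Z k.+2) e')|.
  by rewrite ler_peMr.
lra.
Qed.

(** * The logarithmic inequalities and their contradiction *)

(** Here [x], [a], [b], [c] are the logarithms of the heights at [k+1], [k+2], [j-1], [j], and [p],
    [u], [s] those of the forms at [k], [k+1], [j-2]. *)
Lemma escape_arith (R : realFieldType) (gam g K x a b c p u s : R) :
  0 < g -> g ^+ 2 + g + 1 < gam -> 0 <= K ->
  p + gam * x <= K -> s + gam * b <= K ->
  gam * a <= gam * g * x + K -> gam * c <= gam * g * b + K ->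
  - (gam * g * x) - K <= u ->
  - K <= p + x + a + c -> u + a <= s + b + K ->
  (gam - 1) * (gam - 1 - g - g ^+ 2) * x <= (4 * gam + 2 * g) * K.
Proof.
move=> g0 ggam K0 px sb ax cb ux pxac ua.
have gam1 : 1 < gam by nra.
have scale y z : gam * y <= gam * g * z + K -> y <= g * z + K.
  move=> H; rewrite -(ler_pM2l (lt_trans ltr01 gam1)) mulrDr mulrA.
  by rewrite (le_trans H) // lerD2l ler_peMl // ltW.
have {ax}aK := scale _ _ ax; have {scale cb}cK := scale _ _ cb.
have E1 : (gam - 1) * x <= 2 * K + a + c by lra.
have E2 : (gam - 1) * b <= 3 * K - a + gam * g * x by lra.
(* The weights [gam - 1] and [g] eliminate [c] and [b]. The coefficient left on [a] is
   [gam - 1 - g], which is positive, so the growth bound on [a] applies. *)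
have F1 : (gam - 1) * ((gam - 1) * x) <= (gam - 1) * (3 * K + a + g * b).
  by rewrite ler_wpM2l; lra.
have F2 : g * ((gam - 1) * b) <= g * (3 * K - a + gam * g * x).
  by rewrite ler_wpM2l // ltW.
have F3 : (gam - 1 - g) * a <= (gam - 1 - g) * (g * x + K).
  by rewrite ler_wpM2l //; nra.
nra.
Qed.

Lemma ms_hgt_homo (R : realType) (U : 'M[R]_4) Z (ms : minimal_seq U Z) i j :
  (i <= j)%N -> hgt (Z i) <= hgt (Z j).
Proof.
apply: (homo_leq (f := fun i => hgt (Z i)) (r := <=%R)) => //.
  by move=> y x z; apply: le_trans.
by move=> k; apply/ltW/(ms_hgt_incr ms).
Qed.

Lemma ms_form_homo (R : realType) (U : 'M[R]_4) Z (ms : minimal_seq U Z) i j :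
  (i <= j)%N -> lform (Z j) <= lform (Z i).
Proof.
apply: (homo_leq (f := fun i => lform (Z i)) (r := fun x y => y <= x)) => //.
  by move=> y x z xy yz; apply: le_trans yz xy.
by move=> k; apply/ltW/(ms_form_decr ms).
Qed.

Lemma exponents_incompatible (R : realType) (U : 'M[R]_4) Z
    (ms : minimal_seq U Z) (gam g K : R) :
  \det U = 1 -> 0 < g -> g ^+ 2 + g + 1 < gam -> 0 <= K ->
  (forall i, ln (lform (Z i)) + gam * ln (hgt (Z i.+1)) <= K) ->
  (forall i, - (gam * g * ln (hgt (Z i))) - K <= ln (lform (Z i))) ->
  (forall M, exists N, forall i, (N <= i)%N -> M <= ln (hgt (Z i))) ->
  False.
Proof.
move=> U1 g0 ggam K0 unif indiv unbd.
have gam1 : 1 < gam by nra.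
have fp i : lform (Z i) \is Num.pos by rewrite posrE (ms_form_gt0 ms).
have hp i : hgt (Z i) \is Num.pos by rewrite posrE (ms_hgt_gt0 ms).
have f0 i := ms_form_gt0 ms i; have h0 i := ms_hgt_gt0 ms i.
have grow i : gam * ln (hgt (Z i.+1)) <= gam * g * ln (hgt (Z i)) + 2 * K.
  by have := unif i; have := indiv i; lra.
(* By [unif] the logarithm of the product is at most [K - (gam - 1) * ln (hgt (Z j.+1))]. *)
have small e N : 0 < e ->
    exists2 j, (N <= j)%N & lform (Z j) * hgt (Z j.+1) < e.
  move=> e0; have [N' NP] := unbd ((K - ln e + 1) / (gam - 1)).
  exists (maxn N N'); first exact: leq_maxl.
  set j := maxn N N'.
  have /NP : (N' <= j.+1)%N by rewrite leqW // leq_maxr.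
  rewrite ler_pdivrMr; last lra.
  rewrite -ltr_ln ?posrE ?mulr_gt0 // lnM //; have := unif j; nra.
have noncop := noncoplanar_cofinal ms small.
pose esc N := exists k j, [/\ (N <= k)%N, (k <= j)%N, ~~ coplanar Z k &
  ~~ (Z j <= span3 Z k)%MS].
(* Either the points keep leaving the hyperplanes spanned by late triples, or from some index on
   they stay in one. *)
have [all_esc|] := pselect (forall N, esc N).
  (* [K'] covers the [2 * K] of [grow], the 24 of the determinant and the 4 of [coplanar_run]. *)
  set K' := 2 * K + ln 24.
  have ln24 : 0 <= ln 24 :> R by rewrite ln_ge0 // ler1n.
  have ln4 : ln 4 <= ln 24 :> R by rewrite ler_ln ?posrE ?ltr0n // ler_nat.
  have Q0 : 0 < (gam - 1) * (gam - 1 - g - g ^+ 2) by rewrite mulr_gt0; lra.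
  (* Beyond [N] the left side of [escape_arith] exceeds its right side by at least 1. *)
  have [N NP] := unbd (((4 * gam + 2 * g) * K' + 1) /
                       ((gam - 1) * (gam - 1 - g - g ^+ 2))).
  have [k0 [j0 [Nk0 kj0 ck0 jk0]]] := all_esc N.
  have [|k [j [Nk kj ck jk cop]]] := @minimal_escape _ Z N k0 j0 _ ck0 jk0.
    by rewrite Nk0.
  have := NP k.+1 (leqW Nk); rewrite ler_pdivrMr // mulrC => big.
  suff : (gam - 1) * (gam - 1 - g - g ^+ 2) * ln (hgt (Z k.+1)) <=
         (4 * gam + 2 * g) * K' by lra.
  have kj' : (k <= j)%N by apply: leq_trans kj; rewrite -addn3 leq_addr.
  have jE : j = (k.+1 + (j - k.+3)).+2 by move: kj; clear; lia.
  set m := (k.+1 + (j - k.+3))%N in jE.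
  have run : lform (Z k.+1) * hgt (Z k.+2) <= 4 * (lform (Z m) * hgt (Z m.+1)).
    by apply: (coplanar_run ms) => i Hi; apply: cop; move: Hi kj; clear; lia.
  apply: (escape_arith (a := ln (hgt (Z k.+2))) (b := ln (hgt (Z m.+1)))
    (c := ln (hgt (Z j))) (p := ln (lform (Z k))) (u := ln (lform (Z k.+1)))
    (s := ln (lform (Z m)))) => //.
  - by rewrite /K'; lra.
  - by have := unif k; rewrite /K'; lra.
  - by have := unif m; rewrite /K'; lra.
  - by have := grow k.+1; rewrite /K'; lra.
  - by have := grow m.+1; rewrite -jE /K'; lra.
  - by have := indiv k.+1; rewrite /K'; lra.
  - have d0 := det_span3 ms ck jk.
    have d1 : 1 <= `|\det (stack4 (Z k) (Z k.+1) (Z k.+2) (Z j))|.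
      apply: lattice_det U1 _ d0 => i; rewrite rowK.
      by case: i => [[|[|[|[|//]]]] Hi] //=; apply: ms_lattice ms _.
    have wp : lform (Z j) * hgt (Z k) <= lform (Z k) * hgt (Z j).
      apply: ler_pM; [exact/ltW/f0|exact/ltW/h0| |].
        exact: ms_form_homo ms _ _ kj'.
      exact: ms_hgt_homo ms _ _ kj'.
    have := le_trans d1 (det_stack4_le (ms_form_homo ms (leqnSn k))
      (ms_form_homo ms (leqW (leqnSn k))) (ms_hgt_homo ms (leqnSn k))
      (ms_hgt_homo ms (leqW (leqnSn k))) wp).
    rewrite -ler_ln ?posrE ?mulr_gt0 // ln1 !lnM ?posrE ?mulr_gt0 //.
    by rewrite /K'; lra.
  - move: run; rewrite -ler_ln ?posrE ?mulr_gt0 // !lnM ?posrE ?mulr_gt0 //.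
    by rewrite /K'; lra.
move=> /existsNP[N nesc]; have [k0 Nk0 ck0] := noncop N.
have inH j : (k0 <= j)%N -> (Z j <= span3 Z k0)%MS.
  by move=> kj; apply: contrapT => /negP jk; apply: nesc; exists k0, j.
have [tau tau0 gap] := hyperplane_gap ms U1 (leqnn k0) ck0 inH.
(* [gap], [unif] and [grow] bound [gam * (gam - 1 - g) * ln (hgt (Z k.+1))] by
   [3 * gam * K - gam * ln tau]; the added 1 contradicts this. *)
have [N' NP] := unbd ((3 * gam * K - gam * ln tau + 1) / (gam * (gam - 1 - g))).
have [k Nk ck] := noncop (maxn k0 N').
have /NP : (N' <= k.+1)%N by apply: leqW; apply: leq_trans Nk; apply: leq_maxr.
rewrite ler_pdivrMr; last by rewrite mulr_gt0 //; nra.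
have := gap k (leq_trans (leq_maxl _ _) Nk) ck.
rewrite -ler_ln ?posrE ?mulr_gt0 // !lnM ?posrE ?mulr_gt0 // => T1 T2.
have T3 := unif k; have T4 := grow k.+1.
have T5 : gam * ln tau <= gam * (ln (lform (Z k)) + ln (hgt (Z k.+1)) + ln (hgt (Z k.+2))).
  by rewrite ler_wpM2l //; lra.
have T6 : gam * (ln (lform (Z k)) + gam * ln (hgt (Z k.+1))) <= gam * K.
  by rewrite ler_wpM2l //; lra.
have T7 : K <= gam * K by rewrite ler_peMl // ltW.
nra.
Qed.

(** * The lattice of a linear form in three variables *)

(** The rows are a basis of the lattice of vectors [(n + L(x), x)]. *)
Definition form_mx (R : realType) (Theta : 'M[R]_(1, 3)) : 'M[R]_4 :=
  block_mx (1%:M : 'M[R]_1) 0 (Theta^T) (1%:M : 'M[R]_3).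

Definition form_vec (R : realType) (Theta : 'M[R]_(1, 3)) (n : int)
    (x : 'rV[int]_3) : 'rV[R]_4 :=
  row_mx (n%:~R + linform Theta 0 x)%:M (map_mx intr x : 'rV[R]_3).

Lemma det_form_mx (R : realType) (Theta : 'M[R]_(1, 3)) :
  \det (form_mx Theta) = 1.
Proof. by rewrite [LHS](@det_lblock _ 1 3) !det1 mulr1. Qed.

Lemma form_vecE (R : realType) (Theta : 'M[R]_(1, 3)) n x :
  form_vec Theta n x =
    map_mx intr (row_mx n%:M x : 'rV[int]_(1 + 3)) *m form_mx Theta.
Proof.
rewrite /form_mx (map_row_mx intr (n%:M : 'M[int]_1) x).
rewrite [RHS](@mul_row_block _ 1 1 3 1 3) mulmx0 !mulmx1 add0r.
rewrite /form_vec; set a := _%:M; set b := _ + _; suff -> : b = a by [].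
rewrite /a /b; apply/rowP => i; rewrite ord1 !mxE eqxx.
by congr (_ + _); apply: eq_bigr => l _; rewrite !mxE mulrC.
Qed.

Lemma lattice_form_vec (R : realType) (Theta : 'M[R]_(1, 3)) n x :
  lattice (form_mx Theta) (form_vec Theta n x).
Proof. by rewrite form_vecE; exists (row_mx n%:M x). Qed.

Lemma lattice_form_vecP (R : realType) (Theta : 'M[R]_(1, 3)) v :
  lattice (form_mx Theta) v -> exists n x, v = form_vec Theta n x.
Proof.
move=> [z ->].
exists ((lsubmx (z : 'rV_(1 + 3))) 0 0), (rsubmx (z : 'rV_(1 + 3))).
rewrite form_vecE; congr (map_mx _ _ *m _).
by rewrite -mx11_scalar hsubmxK.
Qed.

Lemma lform_form_vec (R : realType) (Theta : 'M[R]_(1, 3)) n x :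
  lform (form_vec Theta n x) = `|n%:~R + linform Theta 0 x|.
Proof.
have E := row_mxEl (n%:~R + linform Theta 0 x)%:M (map_mx intr x : 'rV[R]_3) 0 0.
rewrite [RHS]mxE eqxx mulr1n in E; rewrite /lform -E; congr `|_|.
by congr (form_vec _ _ _ _ _); apply: val_inj.
Qed.

Lemma form_vec_rshift (R : realType) (Theta : 'M[R]_(1, 3)) n x (l : 'I_3) :
  form_vec Theta n x 0 (rshift 1 l) = (x 0 l)%:~R.
Proof.
have := row_mxEr (n%:~R + linform Theta 0 x)%:M (map_mx intr x : 'rV[R]_3) 0 l.
by rewrite [X in _ = X]mxE => <-.
Qed.

Lemma hgt_form_vec (R : realType) (Theta : 'M[R]_(1, 3)) n x :
  hgt (form_vec Theta n x) = (height x)%:~R.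
Proof.
apply/eqP; rewrite eq_le; apply/andP; split.
  apply: hgt_le => [|l l0].
    by rewrite ler0z; apply: (@bigmax_ge_id _ _ _ _ _ _ (fun=> _)).
  have -> : l = rshift 1 (inord l.-1 : 'I_3).
    apply: val_inj; rewrite /= inordK; last by have := ltn_ord l; move: l0; rewrite -val_eqE /=; lia.
    by move: l0; rewrite -val_eqE /=; lia.
  rewrite form_vec_rshift -intr_norm ler_int.
  exact: (le_bigmax _ (fun i => `|x 0 i|)).
have [m mP] : exists m, forall i : 'I_3, `|x 0 i| <= `|x 0 m|.
  exists [arg max_(i > (ord0 : 'I_3)) `|x 0 i|]%O.
  by case: arg_maxP => // i _ iP j; apply: iP.
have hm : height x <= `|x 0 m| by apply: bigmax_le => // i _; apply: mP.
apply: le_trans (_ : `|x 0 m|%:~R <= _); first by rewrite ler_int.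
by rewrite intr_norm -(form_vec_rshift Theta n); apply: hgt_ge; rewrite -val_eqE.
Qed.

(** * Distance to the nearest integer and Dirichlet's bound *)

(** An integer within 1/2 of [t] attains the infimum, since any other is at distance at least 1 from
    it. The sign of [n] is that of [form_vec]. *)
Lemma dist_intP (R : realType) (t : R) :
  exists n : int, [/\ dist_int t = `|n%:~R + t|, dist_int t <= 2^-1 &
    forall m : int, dist_int t <= `|m%:~R + t|].
Proof.
have [n nt] := near_int t; exists (- n).
have le_n (m : int) : `|t - n%:~R| <= `|t - m%:~R|.
  have [->//|nm] := eqVneq n m.
  apply: (le_trans nt).
  have : 1 <= `|(n - m)%:~R : R|.
    by rewrite -intr_norm -[1]/(1%:~R) ler_int; move: nm; rewrite -subr_eq0; lia.
  have := ler_distD t n%:~R m%:~R; rewrite intrB (distrC n%:~R t) => a b.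
  move: nt a b; set p := `|t - _|; set q := `|t - _|; lra.
have E : dist_int t = `|t - n%:~R|.
  apply/eqP; rewrite eq_le; apply/andP; split.
    apply: ge_inf; last by exists n.
    by exists 0 => _ [k _ <-]; apply: normr_ge0.
  apply: lb_le_inf; first by exists `|t - n%:~R|, n.
  by move=> _ [k _ <-].
rewrite E; split; [by rewrite intrN addrC|by []|move=> m].
by rewrite (le_trans (le_n (- m))) // intrN opprK addrC.
Qed.

Lemma approxE (R : realType) (Theta : 'M[R]_(1, 3)) x :
  Defs.approx Theta x = dist_int (linform Theta 0 x).
Proof.
rewrite /Defs.approx big_ord_recl big_ord0 max_l //.
by have [n [-> _ _]] := dist_intP (linform Theta ord0 x); apply: normr_ge0.
Qed.

Lemma height_gt0 m (x : 'rV[int]_m) : (0 < height x) = (x != 0).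
Proof.
apply/idP/idP => [|x0].
  by apply: contraTneq => ->; rewrite -leNgt; apply: bigmax_le => // i _; rewrite mxE.
have [i xi] : exists i, x 0 i != 0.
  apply: contrapT => nex; move/eqP: x0; apply; apply/rowP => i; rewrite mxE.
  by apply/eqP; apply: contrapT => /negP ?; apply: nex; exists i.
apply: lt_le_trans (le_bigmax 0 (fun i => `|x 0 i|) i).
by rewrite normr_gt0.
Qed.

(** Pigeonhole: [N + 1] fractional parts of multiples of [t] fall into [N] boxes of length
    [1 / N]. *)
Lemma dirichlet1 (R : realType) (t : R) (N : nat) : (0 < N)%N ->
  exists2 k : nat, (0 < k <= N)%N & dist_int (k%:R * t) <= N%:R^-1.
Proof.
case: N => // N _.
pose fr (i : nat) : R := i%:R * t - (Num.floor (i%:R * t))%:~R.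
have fr01 i : 0 <= fr i < 1.
  by have /andP[] := floor_itv (i%:R * t); rewrite intrD /fr => *; apply/andP; split; lra.
pose f (i : 'I_N.+2) : 'I_N.+1 := inord (`|Num.floor (N.+1%:R * fr i)|%N).
have fP (i : 'I_N.+2) : (f i)%:R <= N.+1%:R * fr i < (f i)%:R + 1.
  have /andP[f0 f1] := fr01 i.
  have a0 : 0 <= N.+1%:R * fr i by rewrite mulr_ge0.
  have F0 : 0 <= Num.floor (N.+1%:R * fr i) by rewrite floor_ge0.
  have FN : (`|Num.floor (N.+1%:R * fr i)| < N.+1)%N.
    rewrite -ltz_nat gez0_abs // -(ltr_int R) (le_lt_trans (floor_le _)) //.
    by rewrite -[X in _ < X]mulr1 ltr_pM2l ?ltr0n.
  rewrite /f inordK // -[(`|_|%N)%:R]/((`|_|%N)%:Z%:~R) gez0_abs //.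
  by have := floor_itv (N.+1%:R * fr i); rewrite intrD.
have [i [j [ij fij]]] : exists i j : 'I_N.+2, (i < j)%N /\ f i = f j.
  apply: contrapT => nex.
  have /leq_card : injective f.
    move=> i j fij; apply: val_inj; have [ij|ji|//] := ltngtP i j; case: nex.
      by exists i, j.
    by exists j, i.
  by rewrite !card_ord ltnn.
exists (j - i)%N; first by have := ltn_ord j; lia.
have [_ [_ _]] := dist_intP ((j - i)%:R * t).
move=> /(_ (Num.floor (i%:R * t) - Num.floor (j%:R * t))) /le_trans; apply.
have -> : (Num.floor (i%:R * t) - Num.floor (j%:R * t))%:~R + (j - i)%:R * t = fr j - fr i.
  by rewrite natrB ?(ltnW ij) // intrB /fr; ring.
have /andP[a1 a2] := fP i; have /andP[b1 b2] := fP j.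
rewrite fij in a1 a2; rewrite -(ler_pM2l (ltr0n R N.+1)) mulfV ?pnatr_eq0 //.
rewrite -[X in X * _](@ger0_norm R) // -normrM mulrBr ler_norml.
by apply/andP; split; lra.
Qed.

(** Multiples of the first unit vector give exponent 1, which serves both to continue the minimal
    points and to show [1 <= alpha]. *)
Lemma approx_small (R : realType) (Theta : 'M[R]_(1, 3)) (N : nat) :
  (0 < N)%N -> exists x : 'rV[int]_3, [/\ 0 < height x,
    (height x)%:~R <= N%:R :> R & Defs.approx Theta x <= N%:R^-1].
Proof.
move=> N0; have [k /andP[k0 kN] kP] := dirichlet1 (Theta 0 0) N0.
exists (k%:Z *: delta_mx 0 0); split.
- rewrite height_gt0; apply/eqP => /rowP/(_ 0); rewrite !mxE /= mulr1 => /eqP.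
  by rewrite -[_ == _]/(k == 0%N); move: k0; case: k {kN kP}.
- apply: le_trans (_ : k%:~R <= _); last by rewrite ler_nat.
  rewrite ler_int; apply: bigmax_le => // i _; rewrite !mxE.
  by case: (_ && _); rewrite ?mulr1 ?mulr0 ?normr0.
- rewrite approxE; congr (dist_int _ <= _): kP.
  rewrite /linform (bigD1 ord0) //= big1 ?addr0 => [|i i0].
    by rewrite !mxE /= mulr1 mulrC.
  by rewrite !mxE (negbTE i0) mulr0 mulr0.
Qed.

Lemma form_vec_approx (R : realType) (Theta : 'M[R]_(1, 3)) (x : 'rV[int]_3) :
  exists n, [/\ lform (form_vec Theta n x) = Defs.approx Theta x,
    Defs.approx Theta x < 1 & forall m,
    Defs.approx Theta x <= lform (form_vec Theta m x)].
Proof.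
have [n [nx x1 mx]] := dist_intP (linform Theta 0 x).
exists n; rewrite approxE lform_form_vec; split => //.
  by rewrite (le_lt_trans x1) // invf_lt1 ?ltr0n // ltr1n.
by move=> m; rewrite lform_form_vec.
Qed.

(** * Construction of the minimal points *)

(** [psi] ranges over [x != 0] while minimality concerns all lattice points; those with [x = 0] have
    an integer as form. *)
Lemma form_vec_eq0 (R : realType) (Theta : 'M[R]_(1, 3)) n :
  lform (form_vec Theta n 0) < 1 -> form_vec Theta n 0 = 0.
Proof.
rewrite lform_form_vec /linform big1 ?addr0 => [|i _]; last by rewrite mxE mulr0.
rewrite -intr_norm -[1]/(1%:~R) ltr_int => n1.
have -> : n = 0 by move: n1; clear; lia.
rewrite form_vecE; have -> : row_mx 0%:M 0 = 0 :> 'rV[int]_(1 + 3).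
  by rewrite raddf0 row_mx0.
by rewrite map_mx0 mul0mx.
Qed.

(** The bound [lform v < 1] keeps the nonzero points with [x = 0], of height 0, from competing. *)
Definition minimal_point (R : realType) (U : 'M[R]_4) (v : 'rV[R]_4) : Prop :=
  [/\ lattice U v, 0 < lform v, lform v < 1, 0 < hgt v &
    forall y, lattice U y -> lform y < lform v -> hgt y <= hgt v -> y = 0].

Lemma minimal_point_le (R : realType) (Theta : 'M[R]_(1, 3)) (t : R) :
  (forall n x, n%:~R + linform Theta 0 x = 0 -> x = 0) -> 1 <= t ->
  exists v, [/\ minimal_point (form_mx Theta) v, hgt v <= t &
    forall x, 0 < height x -> (height x)%:~R <= t ->
      lform v <= Defs.approx Theta x].
Proof.
move=> indep t1; have [x [x0 xt _ xmin]] := psi_attained Theta (isT : (0 < 3)%N) t1.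
have [n [nx nx1 _]] := form_vec_approx Theta x.
exists (form_vec Theta n x); split; last first.
- by move=> y y0 yt; rewrite nx xmin.
- by rewrite hgt_form_vec.
split; first exact: lattice_form_vec.
- rewrite lform_form_vec normr_gt0; apply/eqP => /indep x00.
  by rewrite height_gt0 x00 eqxx in x0.
- by rewrite nx.
- by rewrite hgt_form_vec ltr0z.
move=> y /lattice_form_vecP[m [z ->]]; have [->|z0] := eqVneq z 0.
  by move=> m1 _; apply: form_vec_eq0; rewrite (lt_trans m1) // nx.
rewrite nx !hgt_form_vec => zx hz.
have [k [_ _ /(_ m) kz]] := form_vec_approx Theta z.
have := xmin z; rewrite height_gt0 => /(_ z0 (le_trans hz xt)).
by rewrite leNgt (le_lt_trans kz zx).
Qed.

(** With [k] the least height at which some point beats [v], the successor is a best point of height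
    at most [k]. *)
Lemma minimal_point_next (R : realType) (Theta : 'M[R]_(1, 3)) v :
  (forall n x, n%:~R + linform Theta 0 x = 0 -> x = 0) ->
  minimal_point (form_mx Theta) v ->
  exists w, [/\ minimal_point (form_mx Theta) w, lform w < lform v,
    hgt v < hgt w & forall y, lattice (form_mx Theta) y ->
      lform y < lform v -> hgt y < hgt w -> y = 0].
Proof.
move=> indep [lv v0 v1 hv0 vmin].
pose P k := `[< exists x : 'rV[int]_3, [/\ 0 < height x,
  Defs.approx Theta x < lform v & height x = k%:Z] >].
have exP : exists k, P k.
  have [N Nv] : exists N : nat, (lform v)^-1 < N.+1%:R.
    by exists (Num.truncn (lform v)^-1); rewrite truncnS_gt.
  have [x [x0 _ xN]] := @approx_small _ Theta N.+1 isT.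
  exists `|height x|%N; apply/asboolP; exists x; split => //.
    apply: le_lt_trans xN _.
    by rewrite -[ltRHS]invrK ltf_pV2 // posrE ?ltr0n // invr_gt0.
  by rewrite gez0_abs // ltW.
have [k /asboolP[x [x0 xv xk]] kmin] := ex_minnP exP.
have k1 : 1 <= (k%:Z)%:~R :> R by rewrite -[1]/(1%:~R) ler_int -xk; move: x0; clear; lia.
have [w [mw wk wx]] := minimal_point_le indep k1.
have wv : lform w < lform v by rewrite (le_lt_trans _ xv) // wx // xk.
have [lw w0 w1 hw0 wmin] := mw.
have vw : hgt v < hgt w.
  rewrite ltNge; apply/negP => wv'; move: w0.
  by rewrite (vmin w lw wv wv') /lform mxE normr0 ltxx.
exists w; split => // y /lattice_form_vecP[m [z ->]].
have [->|z0] := eqVneq z 0.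
  by move=> m1 _; apply: form_vec_eq0; rewrite (lt_trans m1).
rewrite hgt_form_vec => zv /lt_le_trans/(_ wk); rewrite ltr_int => zk.
have [n [_ _ /(_ m) kz]] := form_vec_approx Theta z.
rewrite -height_gt0 in z0.
have : P `|height z|%N.
  apply/asboolP; exists z; split => //; first exact: le_lt_trans kz zv.
  by rewrite gez0_abs // ltW.
by move/kmin; move: zk z0; clear; lia.
Qed.

Lemma minimal_seq_exists (R : realType) (Theta : 'M[R]_(1, 3)) :
  (forall n x, n%:~R + linform Theta 0 x = 0 -> x = 0) ->
  exists Z, minimal_seq (form_mx Theta) Z.
Proof.
move=> indep; have [v [mv _ _]] := minimal_point_le indep (lexx 1).
pose T := {v | minimal_point (form_mx Theta) v}.
pose next (v : T) := cid (minimal_point_next indep (svalP v)).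
have nextP v' := svalP (next v').
pose step (v : T) : T :=
  exist _ (sval (next v)) (let: And4 m _ _ _ := nextP v in m).
pose z i := iter i step (exist _ v mv : T).
exists (fun i => sval (z i)); split.
- by move=> i; have [] := svalP (z i).
- by move=> i; have [] := svalP (z i).
- by move=> i; have [] := nextP (z i).
- by move=> i; have [] := svalP (z i).
- by move=> i; have [] := nextP (z i).
- by move=> i; have [] := nextP (z i).
Qed.

(** * Transfer between the exponents *)

Lemma limf_esup_bounded (R : realType) (f : R -> \bar R) :
  (limf_esup f (pinfty_nbhs R) < +oo)%E ->
  exists M C : R, forall t, M < t -> (f t <= C%:E)%E.
Proof.
move=> /ereal_inf_lt[_ [V [M [_ MV]] <-] supV].
exists M, (fine (ereal_sup (f @` V))) => t Mt.
have : (f t <= ereal_sup (f @` V))%E.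
  by apply: ereal_sup_ubound; exists t => //; apply: MV.
(* If the supremum is [-oo], [fine] returns 0, which is still an upper bound. *)
case: (ereal_sup _) supV => [r|//|] //= _ fNoo.
exact: le_trans fNoo (leNye _).
Qed.

Lemma limf_einf_lty (R : realType) (f : R -> \bar R) (C : R) :
  (forall M : R, exists2 t, M < t & (f t <= C%:E)%E) ->
  (limf_einf f (pinfty_nbhs R) < +oo)%E.
Proof.
move=> freq; apply: le_lt_trans (ltry C).
rewrite /limf_einf leeNl; apply: le_ereal_inf_tmp => _ [V [M [_ MV]] <-].
have [t Mt ft] := freq M.
apply: (@le_trans _ _ (- f t)%E); first by rewrite leeN2.
by apply: ereal_sup_ubound; exists t => //; apply: MV.
Qed.

Lemma hgt_lattice_int (R : realType) (Theta : 'M[R]_(1, 3)) v :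
  lattice (form_mx Theta) v -> exists2 n : int, 0 <= n & hgt v = n%:~R.
Proof.
move=> /lattice_form_vecP[n [x ->]]; exists (height x); last exact: hgt_form_vec.
by rewrite -(ler_int R) -(hgt_form_vec Theta n) hgt_ge0.
Qed.

(** Heights are integers, so each increase is at least 1. *)
Lemma hgt_unbounded (R : realType) (Theta : 'M[R]_(1, 3)) Z
  (ms : minimal_seq (form_mx Theta) Z) i : i%:R <= hgt (Z i).
Proof.
elim: i => [|i IHi]; first exact: hgt_ge0.
have := ms_hgt_incr ms i; have [m m0 Em] := hgt_lattice_int (ms_lattice ms i).
have [n n0 En] := hgt_lattice_int (ms_lattice ms i.+1).
rewrite Em En ltr_int => mn; rewrite Em in IHi.
have : (m + 1)%:~R <= n%:~R :> R by rewrite ler_int lezD1.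
by apply: le_trans; rewrite intrD -natr1 lerD2r.
Qed.

Lemma minimal_seq_shift (R : realType) (U : 'M[R]_4) Z N :
  minimal_seq U Z -> minimal_seq U (fun i => Z (N + i)%N).
Proof.
move=> ms; split=> i; rewrite ?addnS.
- exact: ms_lattice ms _.
- exact: ms_form_gt0 ms _.
- exact: ms_form_decr ms _.
- exact: ms_hgt_gt0 ms _.
- exact: ms_hgt_incr ms _.
- exact: ms_minimal ms _.
Qed.

(** A minimizer for [psi] beating [Z i] below the next height would be zero, against its positive
    height. *)
Lemma psi_ge_form (R : realType) (Theta : 'M[R]_(1, 3)) Z
    (ms : minimal_seq (form_mx Theta) Z) i t :
  1 <= t -> t < hgt (Z i.+1) -> ((lform (Z i))%:E <= psi Theta t)%E.
Proof.
move=> t1 tZ; have [x [x0 xt -> _]] := psi_attained Theta (isT : (0 < 3)%N) t1.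
have [n [<- _ _]] := form_vec_approx Theta x; rewrite lee_fin leNgt.
apply/negP => /(ms_minimal ms (lattice_form_vec Theta n x)) v0.
have {}v0 : form_vec Theta n x = 0.
  by apply: v0; rewrite hgt_form_vec (le_lt_trans xt).
have := hgt_form_vec Theta n x; rewrite v0 => h0.
have : 0 < hgt (0 : 'rV[R]_4) by rewrite h0 ltr0z.
apply/negP; rewrite -leNgt; apply: hgt_le => // l _.
by rewrite mxE normr0.
Qed.

Lemma psi_le_form (R : realType) (Theta : 'M[R]_(1, 3)) Z
    (ms : minimal_seq (form_mx Theta) Z) i :
  (psi Theta (hgt (Z i)) <= (lform (Z i))%:E)%E.
Proof.
have := ms_lattice ms i => /lattice_form_vecP[n [x E]].
have := ms_hgt_gt0 ms i; rewrite E hgt_form_vec ltr0z => x0.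
have [_ [_ _ /(_ n) xn]] := form_vec_approx Theta x.
apply: (@le_trans _ _ (Defs.approx Theta x)%:E); last by rewrite lee_fin.
by apply: ereal_inf_lbound; exists x.
Qed.

(** If the conclusion failed, [psi] would exceed [t] to the power [- gam * g] for all large [t]; at
    the heights of minimal points this contradicts [exponents_incompatible]. *)
Lemma exponent_transfer (R : realType) (Theta : 'M[R]_(1, 3)) (gam g : R) :
  (forall n x, n%:~R + linform Theta 0 x = 0 -> x = 0) ->
  0 < g -> g ^+ 2 + g + 1 < gam ->
  (limf_esup (fun t : R => (t `^ gam)%:E * psi Theta t) (pinfty_nbhs R)
    < +oo)%E ->
  (limf_einf (fun t : R => (t `^ (gam * g))%:E * psi Theta t) (pinfty_nbhs R)
    < +oo)%E.
Proof.
move=> indep g0 ggam /limf_esup_bounded[M [C0 supC]].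
apply: (@limf_einf_lty _ _ 1).
apply: contrapT => /existsNP[M' nfreq].
have infi t : M' < t -> (1%:E < (t `^ (gam * g))%:E * psi Theta t)%E.
  by move=> Mt; rewrite ltNge; apply/negP => ?; apply: nfreq; exists t.
have [Z0 ms0] := minimal_seq_exists indep.
(* The first [N] points are dropped, so that half of every remaining height exceeds 1, [M] and
   [M']. *)
pose N := (Num.truncn (2 * Num.max 1 (Num.max M M'))).+1.
have NM : 2 * Num.max 1 (Num.max M M') < N%:R by rewrite truncnS_gt.
pose Z i := Z0 (N + i)%N.
have ms : minimal_seq (form_mx Theta) Z := minimal_seq_shift N ms0.
have big i : [/\ 1 <= hgt (Z i) / 2, M < hgt (Z i) / 2 & M' < hgt (Z i)].
  have : N%:R + i%:R <= hgt (Z i) by rewrite -natrD (hgt_unbounded ms0).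
  have : 0 <= i%:R :> R by [].
  have a1 : 1 <= Num.max 1 (Num.max M M') by rewrite le_max lexx.
  have a2 : M <= Num.max 1 (Num.max M M') by rewrite !le_max lexx orbT.
  have a3 : M' <= Num.max 1 (Num.max M M') by rewrite !le_max lexx !orbT.
  move: NM a1 a2 a3; set m := Num.max _ _ => *; split; lra.
pose C := Num.max 1 C0.
have C1 : 1 <= C by rewrite le_max lexx.
have gam0 : 0 < gam by nra.
have ln2 : 0 <= ln 2 :> R by rewrite ln_ge0 // ler1n.
apply: (@exponents_incompatible _ _ Z ms gam g (ln C + gam * ln 2)) => //.
- exact: det_form_mx.
- by rewrite addr_ge0 ?ln_ge0 // mulr_ge0 // ltW.
- move=> i; have [b1 b2 _] := big i.+1.
  have h0 := ms_hgt_gt0 ms i.+1; have f0 := ms_form_gt0 ms i.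
  have hp : hgt (Z i.+1) / 2 < hgt (Z i.+1) by lra.
  have p0 : 0 < (hgt (Z i.+1) / 2) `^ gam by rewrite powR_gt0; lra.
  (* [psi_ge_form] needs [t] strictly below the next height; taking half of it costs the term
     [gam * ln 2]. *)
  have : (hgt (Z i.+1) / 2) `^ gam * lform (Z i) <= C.
    apply: (@le_trans _ _ C0); last by rewrite le_max lexx orbT.
    rewrite -lee_fin EFinM; apply: le_trans (supC _ b2).
    by rewrite lee_pmul2l ?lte_fin // psi_ge_form.
  rewrite -ler_ln ?posrE ?mulr_gt0 ?(lt_le_trans _ C1) // lnM ?posrE //.
  by rewrite ln_powR ln_div ?posrE //; lra.
- move=> i; have [_ _ b] := big i.
  have h0 := ms_hgt_gt0 ms i; have f0 := ms_form_gt0 ms i.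
  have p0 : 0 < hgt (Z i) `^ (gam * g) by rewrite powR_gt0.
  have : 1 <= hgt (Z i) `^ (gam * g) * lform (Z i).
    rewrite -lee_fin EFinM; apply: (le_trans (ltW (infi _ b))).
    by rewrite lee_pmul2l ?lte_fin // psi_le_form.
  rewrite -ler_ln ?posrE ?mulr_gt0 // lnM ?posrE // ln1 ln_powR.
  have : 0 <= gam * ln 2 by rewrite mulr_ge0 // ltW.
  have := ln_ge0 C1; lra.
- move=> L; exists (Num.truncn (expR L)).+1 => i iL.
  have h0 := ms_hgt_gt0 ms i.
  rewrite -(expRK L) ler_ln ?posrE ?expR_gt0 //.
  apply: le_trans (hgt_unbounded ms i).
  by apply: le_trans (ltW (truncnS_gt _)) _; rewrite ler_nat.
Qed.

(** Dirichlet's bound with [N] the integer part of [t]; the constant 2 comes from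
    [t < N + 1 <= 2 N]. *)
Lemma limf_esup_psi1 (R : realType) (Theta : 'M[R]_(1, 3)) :
  (limf_esup (fun t : R => (t `^ 1)%:E * psi Theta t) (pinfty_nbhs R) < +oo)%E.
Proof.
apply: le_lt_trans (ltry (2 : R)).
pose V := [set t : R | 1 < t].
apply: (@le_trans _ _ (ereal_sup [set ((t `^ 1)%:E * psi Theta t)%E | t in V])).
  apply: ereal_inf_lbound; exists V => //.
  by exists 1; split => //; apply: num_real.
apply: ge_ereal_sup => _ [t /= t1 <-].
have t0 : 0 < t by apply: lt_trans t1.
rewrite powRr1 ?(ltW t0) //.
have /andP[Nt tN] : (Num.truncn t)%:R <= t < (Num.truncn t).+1%:R.
  by apply: truncn_itv; apply: ltW.
have N0 : (0 < Num.truncn t)%N by rewrite truncn_gt0 ltW.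
have [x [x0 xN xs]] := approx_small Theta N0.
apply: (@le_trans _ _ (t%:E * (Defs.approx Theta x)%:E)%E).
  rewrite lee_pmul2l ?lte_fin //; apply: ereal_inf_lbound; exists x => //.
  by split => //; apply: le_trans Nt.
rewrite -EFinM lee_fin.
have N1 : 1 <= (Num.truncn t)%:R :> R by rewrite ler1n.
apply: (@le_trans _ _ (t * (Num.truncn t)%:R^-1)); first by rewrite ler_pM2l.
rewrite ler_pdivrMr; last by rewrite ltr0n.
by move: tN; rewrite -natr1; lra.
Qed.

Lemma uniform_le_individual (R : realType) (Theta : 'M[R]_(1, 3)) :
  (uniform_exponent Theta <= individual_exponent Theta)%E.
Proof.
apply: ge_ereal_sup => _ [gam [gam0 H] <-]; apply: ereal_sup_ubound.
exists gam => //; split => //.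
have [M [C MC]] := limf_esup_bounded H.
apply: (@limf_einf_lty _ _ C) => M'; exists (Num.max M M' + 1).
  by rewrite ltr_pwDr // le_max lexx orbT.
by apply: MC; rewrite ltr_pwDr // le_max lexx.
Qed.

(** * Elementary estimates of [g2] *)

(** Squaring reduces the claim to [a + 3 / a <= 4], that is, [0 <= (a - 1) (3 - a)]. *)
Lemma g2_le1 (R : realType) (a : R) : 1 <= a <= 3 -> g2 a <= 1.
Proof.
move=> /andP[a1 a3]; rewrite /g2 -exprVn.
have a0 : 0 < a by lra.
have ai : a * a^-1 = 1 by rewrite mulfV // gt_eqF.
have i0 : 0 < a^-1 by rewrite invr_gt0.
have i1 : a^-1 <= 1 by rewrite invf_le1.
set i := a^-1 in ai i0 i1 *.
suff : Num.sqrt (a + i ^+ 2 - 7 / 4) <= 3 / 2 - i by lra.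
have c0 : 0 <= 3 / 2 - i by lra.
rewrite -[leRHS](ger0_norm c0) -sqrtr_sqr ler_wsqrtr //.
have : 0 <= i * ((a - 1) * (3 - a)).
  by rewrite mulr_ge0 ?(ltW i0) // mulr_ge0 // subr_ge0.
have -> : i * ((a - 1) * (3 - a)) = (a * i) * (4 - a) - 3 * i by ring.
by rewrite ai; nra.
Qed.

(** Squaring [h + 1/2 - i < r] with [i = 1 / a] gives [h^2 + h + 1 < a - 1 + i (2 h + 1)], so
    [2 h + 1 <= a] suffices. *)
Lemma lt_g2 (R : realType) (a h : R) : 3 < a -> 0 < h -> h < g2 a ->
  h ^+ 2 + h + 1 < a.
Proof.
move=> a3 h0; rewrite /g2 -exprVn.
have ai : a * a^-1 = 1 by rewrite mulfV // gt_eqF //; lra.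
have i0 : 0 < a^-1 by rewrite invr_gt0; lra.
set i := a^-1 in ai i0 *; set s := a + i ^+ 2 - 7 / 4; set r := Num.sqrt s => hr.
have i3 : i < 1 / 3 by nra.
have s0 : 0 <= s by rewrite /s; nra.
have r0 : 0 <= r := sqrtr_ge0 _.
have rs : r ^+ 2 = s := sqr_sqrtr s0.
(* This yields [2 h + 1 < a]; squared, it amounts to [0 <= (a - 1) (a - 3)]. *)
have ra : r <= a / 2 - i.
  have c0 : 0 <= a / 2 - i by lra.
  rewrite -(ler_sqr r0 c0) rs /s.
  have -> : (a / 2 - i) ^+ 2 = a ^+ 2 / 4 - a * i + i ^+ 2 by field.
  by rewrite ai; nra.
have : (h + 1 / 2 - i) ^+ 2 < s by rewrite -rs ltr_sqr ?nnegrE; lra.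
have -> : (h + 1 / 2 - i) ^+ 2 = h ^+ 2 + h + 1 / 4 - i * (2 * h + 1) + i ^+ 2 by field.
have : i * (2 * h + 1) <= i * a by rewrite ler_pM2l //; lra.
by rewrite [i * a]mulrC ai /s; lra.
Qed.

Theorem theorem3 (R : realType) (theta1 theta2 theta3 : R)
    (theta_indep : forall a0 a1 a2 a3 : int,
       a0%:~R + a1%:~R * theta1 + a2%:~R * theta2 + a3%:~R * theta3 = 0 :> R ->
       [/\ a0 = 0, a1 = 0, a2 = 0 & a3 = 0]) :
  let Theta : 'M[R]_(1, 3) := \row_(i < 3) [:: theta1; theta2; theta3]`_i in
  (uniform_exponent Theta * g2_ext (uniform_exponent Theta)
     <= individual_exponent Theta)%E.
Proof.
cbv zeta; set Theta : 'M[R]_(1, 3) := \row__ _.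
have indep n x : n%:~R + linform Theta 0 x = 0 -> x = 0.
  rewrite /linform !big_ord_recl big_ord0 !mxE /= addr0 => E.
  have [] := theta_indep n (x 0 ord0) (x 0 (lift ord0 ord0))
    (x 0 (lift ord0 (lift ord0 ord0))); first by rewrite -E; ring.
  move=> _ x0 x1 x2; apply/rowP => i; rewrite mxE.
  by case: i => [[|[|[|//]]] Hi]; [apply: etrans x0|apply: etrans x1|
    apply: etrans x2]; congr (x _ _); apply: val_inj.
have a1 : (1%:E <= uniform_exponent Theta)%E.
  by apply: ereal_sup_ubound; exists 1 => //; split => //; apply: limf_esup_psi1.
have ab := uniform_le_individual Theta.
case E : (uniform_exponent Theta) a1 ab => [a| |//].
  rewrite lee_fin /= => a1 ab.
  have [a3|a3] := leP a 3.
    apply: le_trans ab; rewrite -EFinM lee_fin ler_piMr ?(le_trans ler01) //.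
    by rewrite g2_le1 // a1.
  rewrite leNgt; apply/negP.
  case Eb : (individual_exponent Theta) ab => [b| |//] //; rewrite lee_fin => ab.
  rewrite -EFinM lte_fin => bg.
  have a0 : 0 < a by lra.
  have : b / a < g2 a by rewrite ltr_pdivrMr // mulrC.
  (* [h] lies strictly between [b / a] and [g2 a], leaving room for some [gam] near [a] with
     [b < gam * h] and [h^2 + h + 1 < gam]. Then [gam * h] is an admissible individual exponent
     above [b]. *)
  set h := (b / a + g2 a) / 2 => bga.
  have [bh hg] : b / a < h /\ h < g2 a by rewrite /h; split; lra.
  have h0 : 0 < h by apply: le_lt_trans bh; rewrite divr_ge0 //; lra.
  have ha := lt_g2 a3 h0 hg.
  have bha : b / h < a by rewrite ltr_pdivrMr // mulrC -ltr_pdivrMr.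
  have : ((Num.max (b / h) (h ^+ 2 + h + 1))%:E < uniform_exponent Theta)%E.
    by rewrite E lte_fin gt_max bha.
  move=> /ereal_sup_gt[_ [gam [gam0 Hgam] <-]].
  rewrite lte_fin gt_max => /andP[bgam hgam].
  have : ((gam * h)%:E <= individual_exponent Theta)%E.
    apply: ereal_sup_ubound; exists (gam * h) => //; split.
      by rewrite mulr_gt0.
    exact: exponent_transfer.
  by rewrite Eb lee_fin leNgt -ltr_pdivrMr // bgam.
(* An infinite uniform exponent makes the individual one infinite. *)
by move=> _; rewrite leye_eq => /eqP ->.
Qed.
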